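(* Let $\Lambda=\{\lambda_1,\ldots,\lambda_n\}\subset(\mathbb{F}[\bm{x}])'$, $n\ge1$, be a set of linearly independent interpolation conditions on $\mathbb{F}[\bm{x}]=\mathbb{F}[x_1,\ldots,x_d]$ such that $\ker\Lambda$ is an ideal. For $1\le i\le d$, let $\prec_{lex(i)}$ be the lexicographic order with $x_i\succ\cdots\succ x_d\succ x_1\succ\cdots\succ x_{i-1}$. If $$\mathcal{N}_{\prec_{lex(1)}}(\ker\Lambda)=\mathcal{N}_{\prec_{lex(2)}}(\ker\Lambda)=\cdots=\mathcal{N}_{\prec_{lex(d)}}(\ker\Lambda)=\mathcal{O},$$ then $V=\mathrm{span}_{\mathbb{F}}\{\bm{x}^{\bm{\beta}}:\bm{x}^{\bm{\beta}}\in\mathcal{O}\}$ is a minimal degree interpolation space with respect to $\Lambda$.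
   Context: $\mathbb{F}$ is a field of characteristic zero, $(\mathbb{F}[\bm{x}])'$ is the algebraic dual of $\mathbb{F}[\bm{x}]$, and $\ker\Lambda=\{f\in\mathbb{F}[\bm{x}]:\lambda(f)=0\text{ for all }\lambda\in\Lambda\}$. For an ideal $\mathcal{I}$ and a monomial order $\prec$, the Gröbner escalier $\mathcal{N}_\prec(\mathcal{I})$ is the set of monomials not divisible by the leading term of any element of the reduced Gröbner basis of $\mathcal{I}$ with respect to $\prec$. $\Pi_r$ denotes the space of polynomials in $\mathbb{F}[\bm{x}]$ of total degree at most $r$ (with $\Pi_{-1}=\{0\}$). For a finite-dimensional subspace $W\subset\mathbb{F}[\bm{x}]$, the interpolation problem for $(W,\Lambda)$ is poised if for every $f\in\mathbb{F}[\bm{x}]$ there is a unique $p\in W$ with $\lambda_ip=\lambda_if$ for all $1\le i\le n$. Let $r$ be the maximal total degree of elements of $V$, so that $V\subset\Pi_r$. $V$ is a minimal degree interpolation space with respect to $\Lambda$ if: (1) the interpolation problem for $(V,\Lambda)$ is poised; (2) the corresponding interpolation operator $P$ onto $V$ (sending $f$ to its unique interpolant in $V$) is degree-reducing: for each $0\le k\le r$ and each $f\in\Pi_k$, $Pf\in\Pi_k$; (3) $V\subset\Pi_r$ is of minimal degree: there is no subspace $V'\subset\Pi_{r-1}$ for which the interpolation problem for $(V',\Lambda)$ is poised. *)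

(* Defs.v *)
From HB Require Import structures.
From mathcomp Require Import all_boot all_order all_algebra.
From mathcomp.multinomials Require Export mpoly.

Set Implicit Arguments.
Unset Strict Implicit.
Unset Printing Implicit Defensive.

Import Order.TTheory GRing.Theory.
Local Open Scope ring_scope.

(* {mpoly F[d]} is infinite-dimensional, so it has no {vspace _}: its subspaces
   and ideals are Prop-valued predicates. *)
Section LinearAlgebra.

Variables (F : fieldType) (V : lmodType F).

Definition is_subspace (W : V -> Prop) : Prop :=
  W 0 /\ forall (a : F) (u v : V), W u -> W v -> W (a *: u + v).

Definition lin_span (S : V -> Prop) (v : V) : Prop :=
  exists (k : nat) (c : 'I_k -> F) (s : 'I_k -> V),
    (forall j, S (s j)) /\ v = \sum_j c j *: s j.

Definition finite_dim (W : V -> Prop) : Prop :=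
  exists s : seq V, forall v, W v <-> lin_span (fun u => u \in s) v.

Definition functionals_independent (n : nat) (lam : 'I_n -> {scalar V}) : Prop :=
  forall c : 'I_n -> F,
    (forall v, \sum_i c i * lam i v = 0) -> forall i, c i = 0.

Definition common_kernel (n : nat) (lam : 'I_n -> {scalar V}) (v : V) : Prop :=
  forall i, lam i v = 0.

End LinearAlgebra.

Definition is_ideal (R : comNzRingType) (I : R -> Prop) : Prop :=
  [/\ I 0, forall f g, I f -> I g -> I (f + g) & forall h f, I f -> I (h * f)].

Section Groebner.

Variables (F : fieldType) (d : nat).
Implicit Types (le : rel 'X_{1..d}) (I : {mpoly F[d]} -> Prop).
Implicit Types (G : seq {mpoly F[d]}).

(* The leading monomial for an arbitrary monomial order, given by its
   non-strict relation [le]; [mlead] is specific to degrevlex. The value at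
   p = 0 is the dummy 0%MM. *)
Definition lead_monomial le (p : {mpoly F[d]}) : 'X_{1..d} :=
  last 0%MM (sort le (msupp p)).

(* Divisibility of monomials is the componentwise order (_ <= _)%MM. *)
Definition groebner_basis le I G : Prop :=
  (forall g, g \in G -> I g /\ g != 0) /\
  (forall f, I f -> f != 0 ->
     exists2 g, g \in G & (lead_monomial le g <= lead_monomial le f)%MM).

Definition reduced_groebner_basis le I G : Prop :=
  [/\ groebner_basis le I G,
      forall g, g \in G -> g@_(lead_monomial le g) = 1
    & forall g g', g \in G -> g' \in G -> g' != g ->
        forall m, m \in msupp g -> ~~ (lead_monomial le g' <= m)%MM].

(* For an ideal I and a monomial order [le], the reduced Groebner basis exists
   and is unique up to the listing of its elements, so that the quantifier over
   G ranges over the listings of a single finite set. *)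
Definition escalier le I (m : 'X_{1..d}) : Prop :=
  forall G, reduced_groebner_basis le I G ->
    forall g, g \in G -> ~~ (lead_monomial le g <= m)%MM.

End Groebner.

(* Variables are numbered from 0; [rot i m] lists the exponents of m in the
   order x_i, ..., x_(d-1), x_0, ..., x_(i-1). *)
Definition lex_from (d : nat) (i : 'I_d) : rel 'X_{1..d} :=
  fun m1 m2 =>
    ((rot i m1 : seqlexi nat) <= (rot i m2 : seqlexi nat))%O.

Section Interpolation.

Variables (F : fieldType) (d n : nat).
Variable lam : 'I_n -> {scalar {mpoly F[d]}}.
Implicit Types (W V : {mpoly F[d]} -> Prop).

(* As msize f = 1 + deg f, with msize 0 = 0, the space Pi_k is [deg_lt k.+1],
   and Pi_(r-1) is [deg_lt r] for all r >= 0, including Pi_(-1) = {0}. *)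
Definition deg_lt (k : nat) (f : {mpoly F[d]}) : Prop := (msize f <= k)%N.

Definition max_total_degree V (r : nat) : Prop :=
  (exists2 f, V f & msize f = r.+1) /\ forall f, V f -> deg_lt r.+1 f.

Definition interpolates W (f p : {mpoly F[d]}) : Prop :=
  W p /\ forall i, lam i p = lam i f.

Definition poised W : Prop := forall f, exists! p, interpolates W f p.

Definition degree_reducing (r : nat) (P : {mpoly F[d]} -> {mpoly F[d]}) : Prop :=
  forall k, (k <= r)%N -> forall f, deg_lt k.+1 f -> deg_lt k.+1 (P f).

Definition minimal_degree_interpolation_space V : Prop :=
  [/\ is_subspace V, finite_dim V & exists r : nat,
    [/\ max_total_degree V r,
        poised V,
        exists P, (forall f, interpolates V f (P f)) /\ degree_reducing r P
      & ~ exists V', [/\ is_subspace V', forall f, V' f -> deg_lt r f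
                       & poised V']]].

End Interpolation.

(* Main.v *)
Require Import Defs.
From mathcomp Require Import all_boot all_order all_algebra.
From mathcomp Require Import boolp zify.
Local Open Scope ring_scope.

(** Let I be the common kernel of the functionals and N the set of monomials
    that lead no nonzero element of I. For any monomial order the reduced
    Groebner basis of I exists, so the escalier is exactly N ([escalierE]). No
    nonzero element of I is supported on N ([standard_independent]), and every
    monomial m is congruent modulo I to a normal form supported on N, all of
    whose monomials are at most m in the order ([normal_form_monomial]). Hence
    the polynomials are the direct sum of I and the span of N, which is
    poisedness.

    Suppose now that all d orders give the same N = O. By directness the normal
    form p of m is also the same for all of them, so a monomial b of p is at
    most m in each of the d orders. In the i-th order the exponent of x_i is
    compared first, so b_i <= m_i; this being true for every i, b divides m
    ([lex_from_head]). Interpolation therefore replaces each monomial by a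
    combination of its divisors, and reduces degrees.

    Minimality follows: if the interpolant of a monomial of O of maximal degree
    r could be found in degree less than r, interpolating it back would give
    that monomial again, in degree less than r.

    Finiteness comes from the codimension: more than n monomials always support
    a nonzero element of I ([kernel_meets_large_span]), so N has at most n
    elements, and there is at least one since otherwise 1 would lie in I and
    all functionals would vanish. *)

Set Implicit Arguments.
Unset Strict Implicit.
Unset Printing Implicit Defensive.

Import Order.TTheory GRing.Theory.

(** * Monomial orders and leading monomials *)

Section MonomialOrder.

Variable d : nat.
Implicit Types (le : rel 'X_{1..d}) (m : 'X_{1..d}).

(** Well-foundedness is stated as the existence of least elements, for
    arbitrary predicates. *)
Definition monomial_order le : Prop :=
  [/\ total le, transitive le, antisymmetric le,
      forall a m1 m2, le (m1 + a)%MM (m2 + a)%MM = le m1 m2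
    & forall P : 'X_{1..d} -> Prop, (exists m, P m) ->
        exists2 m, P m & forall m', P m' -> le m m'].

(** Lexicographic comparison along a list of variables, in a form suited to
    induction on that list. *)
Definition lexi_on (r : seq 'I_d) : rel 'X_{1..d} := fun m1 m2 =>
  (([seq m1 j | j <- r] : seqlexi nat) <= ([seq m2 j | j <- r] : seqlexi nat))%O.

Lemma lex_fromE (i : 'I_d) : lex_from i = lexi_on (rot i (enum 'I_d)).
Proof.
have E m : rot i m = [seq m j | j <- rot i (enum 'I_d)].
  by rewrite map_rot -[in LHS](map_tnth_enum m).
by apply: funext => m1; apply: funext => m2; rewrite /lex_from !E.
Qed.

(** Choose the least first exponent, then recurse among the monomials that
    attain it. *)
Lemma lexi_on_least (r : seq 'I_d) (P : 'X_{1..d} -> Prop) :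
  (exists m, P m) -> exists2 m, P m & forall m', P m' -> lexi_on r m m'.
Proof.
elim: r P => [|j r IHr] P [m0 Pm0].
  by exists m0 => // m' _; apply: lexi0s.
have exk : exists k, `[< exists2 m, P m & m j = k >].
  by exists (m0 j); apply/asboolP; exists m0.
case: (ex_minnP exk) => k /asboolP[m1 Pm1 m1j] kmin.
have [|m [Pm mj] mmin] := IHr (fun m => P m /\ m j = k); first by exists m1.
exists m => // m' Pm'; rewrite /lexi_on /= lexi_cons mj.
have le_k : (k <= m' j)%N by apply: kmin; apply/asboolP; exists m'.
rewrite leEnat le_k /=; apply/implyP => ge_k.
by apply: mmin; split=> //; apply/eqP; rewrite eqn_leq ge_k.
Qed.

Lemma lex_from_order (i : 'I_d) : monomial_order (lex_from i).
Proof.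
split.
- by move=> m1 m2; apply: le_total.
- by move=> m2 m1 m3; apply: le_trans.
- move=> m1 m2 /le_anti /rot_inj E.
  by apply/mnmP => j; rewrite !(mnm_nth 0%N) E.
- move=> a m1 m2; rewrite lex_fromE /lexi_on.
  elim: (rot i _) => //= j r IHr.
  by rewrite !lexi_cons IHr !leEnat !mnmDE !leq_add2r.
- by rewrite lex_fromE; apply: lexi_on_least.
Qed.

(** The rotation puts the exponent of x_i in first position. *)
Lemma lex_from_head (i : 'I_d) m1 m2 : lex_from i m1 m2 -> (m1 i <= m2 i)%N.
Proof.
have E : rot i (enum 'I_d) = i :: behead (rot i (enum 'I_d)).
  rewrite /rot (drop_nth i) ?size_enum_ord //=.
  by congr (_ :: _); apply/val_inj; rewrite /= nth_enum_ord.
by rewrite lex_fromE E /lexi_on /= lexi_cons => /andP[].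
Qed.

Variables (F : fieldType) (le : rel 'X_{1..d}).
Hypothesis le_order : monomial_order le.
Implicit Types f g p : {mpoly F[d]}.

Lemma msupp_nil_eq0 f : (msupp f == [::]) = (f == 0).
Proof. by rewrite -(mmeasure_msupp0 mdeg) mmeasure_poly_eq0. Qed.

Lemma lead_monomial_in f : f != 0 -> lead_monomial le f \in msupp f.
Proof.
rewrite -msupp_nil_eq0 -(mem_sort le) -size_eq0 -(size_sort le) /lead_monomial.
by case: (sort _ _) => //= m s _; apply: mem_last.
Qed.

Lemma lead_monomial_max f m : m \in msupp f -> le m (lead_monomial le f).
Proof.
have [le_tot le_tr _ _ _] := le_order.
have le_refl m' : le m' m' by have := le_tot m' m'; rewrite orbb.
rewrite -(mem_sort le) /lead_monomial.
have := sort_sorted le_tot (msupp f).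
case/lastP: (sort _ _) => // s x; rewrite last_rcons.
move=> srt; rewrite mem_rcons inE => /predU1P[->//|ms].
move: srt; rewrite -cats1; case/splitPr: ms => s1 s2.
rewrite -catA cat_cons sorted_pairwise // pairwise_cat => /and3P[_ _].
rewrite pairwise_cons => /andP[/allP/(_ x) + _]; apply.
by rewrite mem_cat inE eqxx orbT.
Qed.

Lemma lead_monomialP f m :
  m \in msupp f -> (forall m', m' \in msupp f -> le m' m) ->
  lead_monomial le f = m.
Proof.
move=> mf mmax; have [_ _ le_anti _ _] := le_order.
apply: le_anti; rewrite lead_monomial_max // andbT mmax // lead_monomial_in //.
by rewrite -msupp_nil_eq0; case: (msupp f) mf.
Qed.

(** Translation by a monomial is monotone, so it carries the largest monomial
    of f to the largest monomial of the product. *)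
Lemma lead_monomialMX f a :
  f != 0 -> lead_monomial le ('X_[a] * f) = (lead_monomial le f + a)%MM.
Proof.
move=> f0; have [_ _ _ leD _] := le_order.
have supE m : m \in msupp ('X_[a] * f) = (m \in [seq (m' + a)%MM | m' <- msupp f]).
  rewrite -commr_mpolyX (perm_mem (msuppMX f a)); congr (_ \in _).
  by apply: eq_map => m'; rewrite addmC.
apply: lead_monomialP; first by rewrite supE (map_f (+%MM^~ a)) // lead_monomial_in.
by move=> m; rewrite supE => /mapP[m' m'f ->]; rewrite leD lead_monomial_max.
Qed.

End MonomialOrder.

(** * Ideals of finite codimension *)

Section FiniteCodimension.

Variables (F : fieldType) (d : nat).
Implicit Types (f g p : {mpoly F[d]}) (m b : 'X_{1..d}).

(** More than n monomials are linearly dependent modulo the common kernel of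
    n functionals: a row of the kernel of the matrix of their values gives the
    dependence. *)
Lemma kernel_meets_large_span n (lam : 'I_n -> {scalar {mpoly F[d]}})
    (s : seq 'X_{1..d}) :
  uniq s -> (n < size s)%N ->
  exists f, [/\ common_kernel lam f, f != 0 & {subset msupp f <= s}].
Proof.
move=> us ns.
pose A : 'M[F]_(size s, n) := \matrix_(j, i) lam i 'X_[tnth (in_tuple s) j].
have /rowV0Pn[v /sub_kermxP vA v0] : kermx A != 0.
  by rewrite kermx_eq0 -row_leq_rank -ltnNge (leq_ltn_trans (rank_leq_col A)).
pose f := \sum_j v 0 j *: 'X_[F, tnth (in_tuple s) j].
have fE m : f@_m = \sum_j v 0 j * (tnth (in_tuple s) j == m)%:R.
  by rewrite /f raddf_sum; apply: eq_bigr => j _; rewrite /= mcoeffZ mcoeffX.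
exists f; split.
- move=> i; rewrite /f raddf_sum /=.
  transitivity ((v *m A) 0 i); last by rewrite vA mxE.
  by rewrite mxE; apply: eq_bigr => j _; rewrite linearZ /= !mxE.
- have /rV0Pn[j vj] := v0.
  apply: contraNneq vj => f0; rewrite -(mcoeff0 F (tnth (in_tuple s) j)) -f0 fE.
  rewrite (bigD1 j) //= eqxx mulr1 big1 ?addr0 // => k kj.
  rewrite !(tnth_nth 0%MM) /= nth_uniq //.
  by rewrite (inj_eq val_inj) (negPf kj) mulr0.
- move=> m; apply: contraTT => ms; rewrite -mcoeff_eq0 fE big1 // => j _.
  case: eqP => [E|_]; last by rewrite mulr0.
  by rewrite -E mem_tnth in ms.
Qed.

(** A duplicate-free list of maximal size, which exists because of the bound,
    must exhaust N. *)
Lemma finite_of_bounded_uniq (T : eqType) (N : T -> Prop) n :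
  (forall s : seq T, uniq s -> {in s, forall x, N x} -> (size s <= n)%N) ->
  exists s : seq T, forall x, N x <-> x \in s.
Proof.
move=> bnd.
pose has_size k := `[< exists s : seq T, [/\ uniq s, {in s, forall x, N x} & size s = k] >].
have ex0 : exists k, has_size k by exists 0%N; apply/asboolP; exists [::].
have ub k : has_size k -> (k <= n)%N.
  by move=> /asboolP[s [us sN <-]]; apply: bnd.
case: (ex_maxnP ex0 ub) => k /asboolP[s [us sN sk]] kmax.
exists s => x; split=> [Nx|]; last exact: sN.
apply: contraT => xs; have /kmax : has_size k.+1.
  apply/asboolP; exists (x :: s); split=> /=; rewrite ?xs ?sk //.
  by move=> y /predU1P[->|/sN].
by rewrite ltnn.
Qed.

End FiniteCodimension.

(** * Normal forms *)

Section NormalForms.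

Variables (F : fieldType) (d : nat) (I : {mpoly F[d]} -> Prop).
Hypothesis I_ideal : is_ideal I.
Implicit Types (f g p : {mpoly F[d]}) (m b : 'X_{1..d}).

Lemma ideal0 : I 0. Proof. by case: I_ideal. Qed.
Lemma idealD f g : I f -> I g -> I (f + g). Proof. by case: I_ideal => _ + _; apply. Qed.
Lemma idealM h f : I f -> I (h * f). Proof. by case: I_ideal => _ _; apply. Qed.
Lemma idealZ c f : I f -> I (c *: f).
Proof. by rewrite -mul_mpolyC; apply: idealM. Qed.
Lemma idealB f g : I f -> I g -> I (f - g).
Proof. by move=> If /(idealZ (-1)); rewrite scaleN1r; apply: idealD. Qed.

(** A reduction of monomials extends linearly to polynomials. *)
Lemma reduce_by_monomials (R : 'X_{1..d} -> 'X_{1..d} -> Prop) f :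
  {in msupp f, forall m,
     exists p, {in msupp p, forall b, R m b} /\ I ('X_[m] - p)} ->
  exists p, {in msupp p, forall b, exists2 m, m \in msupp f & R m b}
            /\ I (f - p).
Proof.
rewrite [in X in _ -> X](mpolyE f).
have -> : msupp (\sum_(m <- msupp f) f@_m *: 'X_[m]) = msupp f by rewrite -mpolyE.
elim: (msupp f) => [_|m s IHs red].
  exists 0; rewrite big_nil subr0; split; last exact: ideal0.
  by move=> b; rewrite msupp0.
have [|p [pR Ip]] := IHs; first by move=> m' m's; apply: red; rewrite inE m's orbT.
have [q [qR Iq]] := red m (mem_head _ _).
exists (f@_m *: q + p); split; last first.
  by rewrite big_cons opprD addrACA -scalerBr; apply/idealD/Ip/idealZ.
move=> b /msuppD_le; rewrite mem_cat => /orP[/msuppZ_le/qR Rb|/pR[m' m's Rb]].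
  by exists m => //; apply: mem_head.
by exists m' => //; rewrite inE m's orbT.
Qed.

Variable le : rel 'X_{1..d}.
Hypothesis le_order : monomial_order le.

Definition leads m : Prop := exists f, [/\ I f, f != 0 & lead_monomial le f = m].

(** Multiplying an element of I by a monomial stays in I and translates its
    leading monomial. *)
Lemma leads_up m m' : leads m -> (m <= m')%MM -> leads m'.
Proof.
move=> [f [If f0 <-]] /submK E; exists ('X_[m' - lead_monomial le f] * f).
split; first exact: idealM; last by rewrite lead_monomialMX // addmC.
have := lead_monomialMX le_order (m' - lead_monomial le f)%MM f0.
by rewrite mulf_neq0 // -msupp_nil_eq0 msuppX.
Qed.

(** The leading monomial of a nonzero f in I would be a standard monomial. *)
Lemma standard_independent f :
  I f -> {in msupp f, forall m, ~ leads m} -> f = 0.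
Proof.
move=> If fN; apply/eqP/contraT => f0.
by case: (fN _ (lead_monomial_in le f0)); exists f.
Qed.

(** Division, run on the least monomial without a normal form: it leads some
    f in I, and subtracting a multiple of f leaves monomials that are strictly
    smaller, hence have normal forms. *)
Lemma normal_form_monomial m :
  exists p, {in msupp p, forall b, ~ leads b /\ le b m} /\ I ('X_[m] - p).
Proof.
have [le_tot le_tr le_anti _ le_least] := le_order.
apply: contrapT => bad0.
have [|{bad0}m bad mmin] := le_least (fun m => ~ exists p,
    {in msupp p, forall b, ~ leads b /\ le b m} /\ I ('X_[m] - p)).
  by exists m.
apply: bad.
have [[f [If f0 lf]]|mN] := EM (leads m); last first.
  exists 'X_[m]; rewrite subrr; split; last exact: ideal0.
  by move=> b /mem_msuppXP <-; split=> //; have := le_tot m m; rewrite orbb.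
have fm0 : f@_m != 0 by rewrite -mcoeff_msupp -lf lead_monomial_in.
pose h := 'X_[m] - (f@_m)^-1 *: f.
have hm : m \notin msupp h.
  by rewrite -mcoeff_eq0 mcoeffB mcoeffX mcoeffZ eqxx mulVf // subrr.
have hlt m' : m' \in msupp h -> le m' m /\ m' != m.
  move=> m'h; have m'm : m' != m by apply: contraNneq hm => <-.
  split=> //; move/msuppB_le: m'h; rewrite mem_cat => /orP[/mem_msuppXP E|].
    by rewrite E eqxx in m'm.
  by move=> /msuppZ_le /(lead_monomial_max le_order); rewrite lf.
have [|p [pR Ip]] := @reduce_by_monomials (fun m' b => ~ leads b /\ le b m') h.
  move=> m' /hlt[le_m' ne_m']; apply: contrapT => /mmin le_m.
  by case/eqP: ne_m'; apply: le_anti; rewrite le_m'.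
exists p; split=> [b /pR[m' /hlt[le_m' _] [bN le_b]]|].
  by split=> //; apply: le_tr le_m'.
have -> : 'X_[m] - p = (f@_m)^-1 *: f + (h - p).
  by rewrite /h addrA addrCA subrr addr0.
exact/idealD/Ip/idealZ.
Qed.

(** A minimal leading monomial is 1 or a variable times a standard monomial,
    so finiteness of the standard monomials bounds the reduced basis without
    an appeal to Dickson's lemma. The basis consists of the differences between
    each minimal leading monomial and its normal form. *)
Lemma reduced_groebner_basis_exists (sN : seq 'X_{1..d}) :
  (forall m, ~ leads m <-> m \in sN) ->
  exists G, reduced_groebner_basis le I G /\
            forall m, leads m ->
              exists2 g, g \in G & (lead_monomial le g <= m)%MM.
Proof.
move=> sNP; have [le_tot le_tr le_anti _ _] := le_order.
have [nf nfP] := choice normal_form_monomial.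
pose minl m := leads m /\ forall m', leads m' -> (m' <= m)%MM -> m' = m.
pose cand := 0%MM :: [seq (b + U_(i))%MM | b <- sN, i <- enum 'I_d].
pose M := [seq m <- cand | `[< minl m >]].
have MP m : m \in M -> minl m by rewrite mem_filter => /andP[/asboolP].
have minM m : minl m -> m \in M.
  move=> mm; rewrite mem_filter asboolT //= inE.
  have [//|m0] := eqVneq m 0%MM; rewrite /=.
  have [i mi] : exists i, (U_(i) <= m)%MM.
    apply: contrapT => noU; case/eqP: m0; apply/mnmP => i; rewrite mnm0E.
    by apply/eqP/contraT; rewrite -lep1mP => ?; case: noU; exists i.
  (* Minimality makes the quotient of m by a variable dividing it standard. *)
  rewrite -(submK mi); apply: allpairs_f; last by rewrite mem_enum.
  apply/sNP => /(mm.2 _)/(_ (lem_subr _ _)) E.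
  have := congr1 (fun m : 'X_{1..d} => m i) E; rewrite mnmBE mnm1E eqxx => Ei.
  by move: mi; rewrite lep1mP -Ei => /eqP; case: (m i) Ei => //= k; lia.
have below m : leads m -> exists2 m', m' \in M & (m' <= m)%MM.
  elim: {m}(mdeg m).+1 {-2}m (ltnSn (mdeg m)) => // k IHk m mk Lm.
  have [/minM mM|mnot] := EM (minl m); first by exists m => //; apply: lepm_refl.
  have [m' [Lm' m'm ne]] : exists m', [/\ leads m', (m' <= m)%MM & m' <> m].
    apply: contrapT => H; apply: mnot; split=> // m' Lm' m'm.
    by apply: contrapT => ne; apply: H; exists m'.
  have m'k : (mdeg m' < k)%N.
    rewrite -ltnS (leq_trans _ mk) // ltnS -(submK m'm) mdegD -add1n leq_add2r.
    rewrite lt0n mdeg_eq0; apply: contra_notN ne => /eqP E.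
    by rewrite -(submK m'm) E add0m.
  have [m2 m2M m2m'] := IHk _ m'k Lm'.
  by exists m2 => //; apply: lepm_trans m'm.
pose g m := 'X_[m] - nf m.
have nfm m : leads m -> m \notin msupp (nf m).
  by move=> Lm; apply/negP => /(nfP m).1[].
have gm1 m : leads m -> (g m)@_m = 1.
  by move=> /nfm mn; rewrite mcoeffB mcoeffX eqxx (memN_msupp_eq0 mn) subr0.
have gsupp m b : b \in msupp (g m) -> b = m \/ ~ leads b /\ le b m.
  move=> /msuppB_le; rewrite mem_cat => /orP[/mem_msuppXP->|/(nfP m).1 bm]; first by left.
  by right.
have glead m : leads m -> lead_monomial le (g m) = m.
  move=> Lm; apply: lead_monomialP => //.
    by rewrite mcoeff_msupp gm1 ?oner_neq0.
  move=> b /gsupp[->|[]//]; by have := le_tot m m; rewrite orbb.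
have g0 m : leads m -> g m != 0.
  by move=> Lm; apply: contraTneq (oner_neq0 F) => E; rewrite -(gm1 m Lm) E mcoeff0 eqxx.
have leadsG m : leads m ->
    exists2 h, h \in [seq g m | m <- M] & (lead_monomial le h <= m)%MM.
  move=> /below[m' m'M m'm]; exists (g m'); first exact: map_f.
  by rewrite glead //; case: (MP _ m'M).
exists [seq g m | m <- M]; split=> //; split.
- split=> [_ /mapP[m /MP[Lm _] ->]|f If f0]; last by apply: leadsG; exists f.
  by split; [apply: (nfP m).2 | apply: g0].
- by move=> _ /mapP[m /MP[Lm _] ->]; rewrite glead // gm1.
- move=> _ _ /mapP[m /MP[Lm mmin] ->] /mapP[m' /MP[Lm' _] ->] ne b bg.
  rewrite glead //; apply/negP => m'b.
  have [E|[bN _]] := gsupp _ _ bg; last by apply: bN; apply: leads_up m'b.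
  by case/eqP: ne; rewrite (mmin m' Lm') // -E.
Qed.

(** The escalier quantifies over reduced bases, so that it would contain every
    monomial if there were none: the existence of one is what makes it avoid
    the leading monomials. *)
Lemma escalierE (sN : seq 'X_{1..d}) :
  (forall m, ~ leads m <-> m \in sN) ->
  forall m, escalier le I m <-> ~ leads m.
Proof.
move=> /reduced_groebner_basis_exists[G [redG leadsG]] m; split=> [esc Lm|mN G'].
  by have [g gG] := leadsG m Lm; rewrite (negPf (esc G redG g gG)).
move=> [[G'I _] _ _] g /G'I[Ig g0]; apply/negP => gm.
apply: mN; apply: leads_up gm; by exists g.
Qed.

End NormalForms.

(** * Spans of monomials *)

Section MonomialSpan.

Variables (F : fieldType) (d : nat) (O : 'X_{1..d} -> Prop).

Lemma lin_span_monomialsP (p : {mpoly F[d]}) :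
  lin_span (fun q : {mpoly F[d]} => exists2 b, O b & q = 'X_[b]) p <->
  {in msupp p, forall b, O b}.
Proof.
split=> [[k [c [s [sO ->]]]] b|pO].
  rewrite mcoeff_msupp raddf_sum /= => bs.
  apply: contrapT => nOb; case/eqP: bs; apply: big1 => j _.
  have [b' Ob' ->] := sO j; rewrite mcoeffZ mcoeffX.
  by case: eqP => [E|]; rewrite ?mulr0 // E in Ob' *.
exists (size (msupp p)).
exists (fun j => p@_(tnth (in_tuple (msupp p)) j)).
exists (fun j => 'X_[tnth (in_tuple (msupp p)) j]); split.
  by move=> j; eexists; [apply: pO; apply: (mem_tnth j (in_tuple _))|].
by rewrite [LHS]mpolyE [LHS](big_tnth _ _ (msupp p)).
Qed.

End MonomialSpan.

(** * Interpolation on a common escalier *)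

Theorem theorem9 (F : fieldType) (charF0 : [pchar F] =i pred0)
  (d : nat) (d_gt0 : (0 < d)%N) (n : nat) (n_gt0 : (0 < n)%N)
  (lam : 'I_n -> {scalar {mpoly F[d]}})
  (lam_indep : functionals_independent lam)
  (ker_ideal : is_ideal (common_kernel lam))
  (O : 'X_{1..d} -> Prop)
  (escalierO : forall (i : 'I_d) (m : 'X_{1..d}),
     escalier (lex_from i) (common_kernel lam) m <-> O m) :
  minimal_degree_interpolation_space lam
    (lin_span (fun p : {mpoly F[d]} => exists2 b : 'X_{1..d}, O b & p = 'X_[b])).
Proof.
set V := lin_span _; pose I := common_kernel lam.
pose i0 : 'I_d := Ordinal d_gt0.
have VP p : V p <-> {in msupp p, forall b, O b} by apply: lin_span_monomialsP.
have IB f p : I (f - p) <-> forall i, lam i p = lam i f.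
  split=> H i; last by rewrite linearB /= H subrr.
  by apply/eqP; rewrite eq_sym -subr_eq0 -linearB /= H.
have standard_finite i :
    exists s : seq 'X_{1..d}, forall m, ~ leads I (lex_from i) m <-> m \in s.
  apply: (finite_of_bounded_uniq (n := n)) => s us sN.
  rewrite leqNgt; apply/negP => /(kernel_meets_large_span lam us).
  case=> f [If /eqP f0 fs]; apply: f0.
  apply: (standard_independent (le := lex_from i) If) => m /fs; exact: sN.
have OE i m : O m <-> ~ leads I (lex_from i) m.
  have [s sP] := standard_finite i.
  by rewrite -(escalierE ker_ideal (lex_from_order i) sP) escalierO.
have [sO sOP] : exists s : seq 'X_{1..d}, forall m, O m <-> m \in s.
  by have [s sP] := standard_finite i0; exists s => m; rewrite (OE i0) sP.
have VI f : V f -> I f -> f = 0.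
  move=> /VP Vf If; apply: (standard_independent (le := lex_from i0) If).
  by move=> m /Vf; rewrite (OE i0).
have Vsub f g : V f -> V g -> V (f - g).
  move=> /VP Vf /VP Vg; apply/VP => b /msuppB_le.
  by rewrite mem_cat => /orP[/Vf|/Vg].
(* The normal forms for the various orders agree, so their order bounds hold
   together and amount to divisibility. *)
have nf m : exists p, {in msupp p, forall b, O b /\ (b <= m)%MM} /\ I ('X_[m] - p).
  have nfi i := normal_form_monomial ker_ideal (lex_from_order i) m.
  have [p [pO Ip]] := nfi i0; exists p; split=> // b bp.
  split; first by rewrite (OE i0); case: (pO b bp).
  apply/mnm_lepP => j; have [q [qO Iq]] := nfi j.
  have pq : p = q.
    apply/eqP; rewrite -subr_eq0; apply/eqP/VI.
      apply: Vsub; apply/VP => c; last by move=> /qO[]; rewrite (OE j).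
      by move=> /pO[]; rewrite (OE i0).
    by have := idealB ker_ideal Iq Ip; rewrite opprB addrC addrA subrK.
  by rewrite pq in bp; apply: lex_from_head; case: (qO b bp).
have /choice[P PP] f := reduce_by_monomials ker_ideal (f := f) (fun m _ => nf m).
have PV f : V (P f) by apply/VP => b /(PP f).1[m _ []].
have Pdeg k f : deg_lt k f -> deg_lt k (P f).
  rewrite /deg_lt => fk; rewrite msizeE; apply/bigmax_leqP_seq => b bP _.
  have [m mf [_ /submK E]] := (PP f).1 b bP.
  apply: leq_trans (leq_trans (msize_mdeg_lt mf) fk).
  by rewrite ltnS -E mdegD leq_addl.
(* O is nonempty: otherwise 1 is in I and all functionals vanish. *)
have exO : exists k, has (fun b => mdeg b == k) sO.
  have [b Ob] : exists b, O b.
    apply: contrapT => noO.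
    have P0 : P 1 = 0.
      apply: (VI _ (PV _)); have /VP := PV 1; case E: (msupp (P 1)) => [|b s] bO.
        move/eqP: E; rewrite msupp_nil_eq0 => /eqP ->; exact: ideal0.
      by case: noO; exists b; apply: bO; apply: mem_head.
    have I1 : I 1 by have := (PP 1).2; rewrite P0 subr0.
    have all0 i f : lam i f = 0.
      by have := idealM ker_ideal f I1 i; rewrite mulr1.
    have /eqP := oner_neq0 F; apply.
    apply: (lam_indep (fun=> 1) _ (Ordinal n_gt0)) => f.
    by apply: big1 => i _; rewrite all0 mulr0.
  by exists (mdeg b); apply/hasP; exists b => //; apply/sOP.
have ubO k : has (fun b => mdeg b == k) sO -> (k <= \max_(b <- sO) mdeg b)%N.
  by move=> /hasP[b bO /eqP <-]; apply: leq_bigmax_seq.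
case: (ex_maxnP exO ubO) => r /hasP[b0 b0O /eqP b0r] rmax.
have Vb0 : V 'X_[b0] by apply/VP => b /mem_msuppXP <-; apply/sOP.
split.
- split=> [|a u v /VP Vu /VP Vv]; first by apply/VP => b; rewrite msupp0.
  by apply/VP => b /msuppD_le; rewrite mem_cat => /orP[/msuppZ_le/Vu|/Vv].
- exists [seq 'X_[b] | b <- sO] => v.
  have -> // : V = lin_span (fun u : {mpoly F[d]} => u \in [seq 'X_[b] | b <- sO]).
  congr lin_span; apply: funext => q; apply/propext; split=> [[b Ob ->]|].
    by apply: map_f; apply/sOP.
  by move=> /mapP[b /sOP Ob ->]; exists b.
exists r; split.
- split; first by exists 'X_[b0]; rewrite // msizeX b0r.
  move=> f /VP Vf; rewrite /deg_lt msizeE; apply/bigmax_leqP_seq => b /Vf Ob _.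
  by rewrite ltnS; apply: rmax; apply/hasP; exists b => //; apply/sOP.
- move=> f; exists (P f); split; first by split=> //; apply/IB; apply: (PP f).2.
  move=> q [Vq /IB Iq]; apply/eqP; rewrite -subr_eq0; apply/eqP/VI.
    exact: Vsub.
  have := idealB ker_ideal Iq (PP f).2.
  by rewrite opprB addrC addrA subrK.
- exists P; split; first by move=> f; split=> //; apply/IB; apply: (PP f).2.
  by move=> k _ f; apply: Pdeg.
- move=> [V' [_ V'r /(_ 'X_[b0])[p [[/V'r pr /IB Ip] _]]]].
  (* The monomial and its interpolant p in V' are congruent modulo I, hence
     have the same interpolant in V; that of the monomial is itself. *)
  have E : 'X_[b0] = P p.
    apply/eqP; rewrite -subr_eq0; apply/eqP/VI; first exact: Vsub.
    by have := idealD ker_ideal Ip (PP p).2; rewrite addrA subrK.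
  by have := Pdeg _ _ pr; rewrite /deg_lt -E msizeX b0r ltnn.
Qed.
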